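(* Let $S$ be a finite inverse semigroup with zero $0$, and let $\mathcal{M}$ be the set of all minimal idempotents of $S$. Then (1) the elements of $\mathcal{M}$ commute pairwise; (2) for every $0\neq x\in S$ there exist $e,f\in\mathcal{M}$ such that $exf\neq 0$; (3) for all $x,y\in S$ and all $e,f\in\mathcal{M}$ one has $\{exgyf: g\in\mathcal{M}\}\subset\{0,exyf\}$, and moreover $\{exgyf:g\in\mathcal{M}\}\neq\{0\}$ if $exyf\neq 0$.
   Context: $S^1$ is $S$ with an identity adjoined if $S$ has none; $(a)=S^1aS^1$. A semigroup $T$ with zero is nilpotent if $T^m=\{0\}$ for some $m\in\mathbb{N}$. The radical is $R(S)=\{x\in S:(x)\text{ is a nilpotent semigroup}\}$, a two-sided ideal (equal to $\{0\}$ when $S$ is inverse). In a finite semigroup Green's relations $\mathcal{D}$ and $\mathcal{J}$ coincide, and $\mathcal{D}$-classes are partially ordered by $\mathcal{D}_a\leq\mathcal{D}_b\Leftrightarrow(a)\subset(b)$. A non-zero $\mathcal{D}$-class $D$ is minimal if $D'\leq D$ implies $D'=D$ or $D'=\{0\}$. An idempotent of $S$ is minimal if it is contained in a minimal $\mathcal{D}$-class of $S/R(S)$. *)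

(* Defs.v *)
From HB Require Import structures.
From mathcomp Require Import all_boot boolp.

Set Implicit Arguments.
Unset Strict Implicit.
Unset Printing Implicit Defensive.

Local Open Scope group_scope.
Local Open Scope quotient_scope.

HB.mixin Record hasZeroElement S of Semigroup S := {
  szero : S;
  mul0s : left_zero szero (@mul S);
  muls0 : right_zero szero (@mul S)
}.

#[short(type="finSemigroup0Type")]
HB.structure Definition FinSemigroup0 :=
  {S of hasZeroElement S & Semigroup S & Finite S}.

Bind Scope group_scope with FinSemigroup0.sort.

Notation "0" := (@szero _) : group_scope.

Definition inverse_semigroup (S : finSemigroup0Type) : Prop :=
  forall x : S, exists! y : S, x * y * x = x /\ y * x * y = y.

Section PrincipalIdeals.
Variable S : finSemigroup0Type.
Implicit Types (a b x y : S) (u v : option S) (A B D : {set S}).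

Definition has_identity : bool :=
  [exists e : S, [forall x : S, (e * x == x) && (x * e == x)]].

(* The elements of S^1: [Some s] stands for s in S, and [None] for the
   adjoined identity, which is present only if S has no identity. *)
Definition S1 : {set option S} := [set u | (u != None) || ~~ has_identity].

Definition lmul1 u a : S := if u is Some s then s * a else a.
Definition rmul1 a u : S := if u is Some s then a * s else a.

Definition left_ideal a : {set S} := [set lmul1 u a | u in S1].
Definition right_ideal a : {set S} := [set rmul1 a u | u in S1].
Definition principal_ideal a : {set S} :=
  [set rmul1 (lmul1 u a) v | u in S1, v in S1].

Definition setmul A B : {set S} := [set x * y | x in A, y in B].

(* [iter m (setmul A) A] is the power A^(m+1). *)
Definition nilpotent_subsemigroup A : Prop :=
  exists m : nat, iter m (setmul A) A = [set 0].

Definition radical_set : {set S} :=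
  [set x | `[< nilpotent_subsemigroup (principal_ideal x) >]].

Definition greenL a b : bool := left_ideal a == left_ideal b.
Definition greenR a b : bool := right_ideal a == right_ideal b.
Definition greenD a b : bool := [exists c : S, greenL a c && greenR c b].

Definition Dclass a : {set S} := [set b | greenD a b].
Definition Dclasses : {set {set S}} := [set Dclass a | a : S].

(* Independent of the representatives, since D = J in a finite semigroup. *)
Definition Dclass_le D1 D2 : bool :=
  [exists a : S, exists b : S,
    [&& D1 == Dclass a, D2 == Dclass b &
        principal_ideal a \subset principal_ideal b]].

Definition minimal_Dclass D : Prop :=
  [/\ D \in Dclasses, D <> [set 0] &
      forall D', D' \in Dclasses -> Dclass_le D' D -> D' = D \/ D' = [set 0]].

Lemma S1_some s : Some s \in S1.
Proof. by rewrite inE. Qed.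

Lemma S1_id : exists2 u, u \in S1 & forall a, lmul1 u a = a /\ rmul1 a u = a.
Proof.
case: (boolP has_identity) => [/existsP[e /forallP he]|hN].
  exists (Some e); first exact: S1_some.
  by move=> a; case/andP: (he a) => /eqP ? /eqP ?.
by exists None; rewrite ?inE ?hN.
Qed.

Lemma S1_mul u v : u \in S1 -> v \in S1 ->
  exists2 w, w \in S1 & (forall a, lmul1 w a = lmul1 u (lmul1 v a)) /\
                        (forall a, rmul1 a w = rmul1 (rmul1 a u) v).
Proof.
case: u => [s|] hu; last by move=> hv; exists v.
case: v => [t|] hv; last by exists (Some s).
by exists (Some (s * t)); rewrite ?S1_some //=; split=> a; rewrite mulgA.
Qed.

Lemma lrmul1C u a v : lmul1 u (rmul1 a v) = rmul1 (lmul1 u a) v.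
Proof. by case: u => [s|]; case: v => [t|] //=; rewrite mulgA. Qed.

Lemma principal_ideal_sub a x :
  x \in principal_ideal a -> principal_ideal x \subset principal_ideal a.
Proof.
case/imset2P=> u v hu hv ->; apply/subsetP=> y /imset2P[u' v' hu' hv' ->].
have [w hw [wl _]] := S1_mul hu' hu; have [z hz [_ zr]] := S1_mul hv hv'.
by apply/imset2P; exists w z; rewrite // lrmul1C -wl zr.
Qed.

Lemma mulr_principal_ideal a x : a * x \in principal_ideal a.
Proof.
have [u hu hid] := S1_id; apply/imset2P; exists u (Some x); rewrite ?S1_some //.
by rewrite (hid a).1.
Qed.

Lemma mull_principal_ideal a x : x * a \in principal_ideal a.
Proof.
have [u hu hid] := S1_id; apply/imset2P; exists (Some x) u; rewrite ?S1_some //.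
by rewrite (hid _).2.
Qed.

Lemma principal_ideal0 : principal_ideal 0 = [set 0].
Proof.
apply/setP=> x; rewrite inE; apply/imset2P/eqP => [[u v _ _ ->]|->].
  by case: u => [s|]; case: v => [t|] //=; rewrite ?muls0 ?mul0s.
by exists (Some 0) (Some 0); rewrite ?S1_some //= !mul0s.
Qed.

Lemma principal_ideal_has0 a : 0 \in principal_ideal a.
Proof. by rewrite -(mul0s a) mull_principal_ideal. Qed.

Lemma iter_setmulS A B n : A \subset B ->
  iter n (setmul A) A \subset iter n (setmul B) B.
Proof. by move=> sAB; elim: n => //= n IH; apply: imset2S. Qed.

Lemma iter_setmul0 A n : 0 \in A -> 0 \in iter n (setmul A) A.
Proof.
by move=> A0; elim: n => //= n IH; rewrite -(mul0s 0); apply: imset2_f.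
Qed.

Lemma radical_set_down x y :
  x \in radical_set -> y \in principal_ideal x -> y \in radical_set.
Proof.
rewrite !inE => /asboolP[m hm] hy; apply/asboolP; exists m.
apply/eqP; rewrite eqEsubset -{1}hm iter_setmulS ?principal_ideal_sub //=.
by rewrite sub1set iter_setmul0 ?principal_ideal_has0.
Qed.

Lemma radical_set0 : 0 \in radical_set.
Proof.
by rewrite inE; apply/asboolP; exists 0%N; rewrite /= principal_ideal0.
Qed.

End PrincipalIdeals.

Record ideal (S : finSemigroup0Type) := Ideal {
  ideal_set :> {set S};
  ideal_has0 : 0 \in ideal_set;
  ideal_mull : forall a x, x \in ideal_set -> a * x \in ideal_set;
  ideal_mulr : forall x a, x \in ideal_set -> x * a \in ideal_set
}.

Section ReesQuotient.
Variables (S : finSemigroup0Type) (I : ideal S).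
Implicit Types (x y : S).

Definition rees_rel : rel S :=
  fun x y => (x == y) || ((x \in ideal_set I) && (y \in ideal_set I)).

Lemma rees_refl : reflexive rees_rel.
Proof. by move=> x; rewrite /rees_rel eqxx. Qed.

Lemma rees_sym : symmetric rees_rel.
Proof. by move=> x y; rewrite /rees_rel eq_sym andbC. Qed.

Lemma rees_trans : transitive rees_rel.
Proof.
move=> y x z /orP[/eqP-> //|/andP[hx hy]] /orP[/eqP<-|/andP[_ hz]];
  by rewrite /rees_rel hx ?hy ?hz orbT.
Qed.

Canonical rees_equiv := EquivRel rees_rel rees_refl rees_sym rees_trans.

Definition rees := {eq_quot rees_equiv}.
HB.instance Definition _ := EqQuotient.on rees.
HB.instance Definition _ : isCountable rees := CanIsCountable (@reprK _ rees).
HB.instance Definition _ : isFinite rees := CanIsFinite (@reprK _ rees).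

Definition rees_mul (p q : rees) : rees := \pi_rees (repr p * repr q).

Lemma rees_piE x y : (\pi_rees x == \pi_rees y) = rees_rel x y.
Proof. by rewrite piE. Qed.

Lemma rees_repr x : rees_rel (repr (\pi_rees x)) x.
Proof. by rewrite -rees_piE reprK. Qed.

Lemma rees_mul_pi x y : rees_mul (\pi_rees x) (\pi_rees y) = \pi_rees (x * y).
Proof.
apply/eqP; rewrite rees_piE.
apply: (@rees_trans (x * repr (\pi_rees y))).
  case/orP: (rees_repr x) => [/eqP->|/andP[h1 h2]]; first exact: rees_refl.
  by rewrite /rees_rel !ideal_mulr ?orbT.
case/orP: (rees_repr y) => [/eqP->|/andP[h1 h2]]; first exact: rees_refl.
by rewrite /rees_rel !ideal_mull ?orbT.
Qed.

Lemma rees_mulA : associative rees_mul.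
Proof.
move=> p q r; rewrite -[p]reprK -[q]reprK -[r]reprK.
rewrite (rees_mul_pi (repr q) (repr r)) (rees_mul_pi (repr p) (repr q)).
by rewrite !rees_mul_pi mulgA.
Qed.

HB.instance Definition _ := isSemigroup.Build rees rees_mulA.

Lemma rees_mul0s : left_zero (\pi_rees 0) (@mul rees).
Proof.
by move=> p; rewrite -[p]reprK [LHS]rees_mul_pi mul0s.
Qed.

Lemma rees_muls0 : right_zero (\pi_rees 0) (@mul rees).
Proof.
by move=> p; rewrite -[p]reprK [LHS]rees_mul_pi muls0.
Qed.

HB.instance Definition _ := hasZeroElement.Build rees rees_mul0s rees_muls0.

End ReesQuotient.

Section Radical.
Variable S : finSemigroup0Type.

Lemma radical_mull (a x : S) : x \in radical_set S -> a * x \in radical_set S.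
Proof. by move/radical_set_down; apply; apply: mull_principal_ideal. Qed.

Lemma radical_mulr (x a : S) : x \in radical_set S -> x * a \in radical_set S.
Proof. by move/radical_set_down; apply; apply: mulr_principal_ideal. Qed.

Definition radical : ideal S :=
  Ideal (radical_set0 S) radical_mull radical_mulr.

(* "e belongs to a class of S/R(S)" is read through the projection, which is
   injective outside R(S) and sends R(S) to the zero of S/R(S). *)
Definition minimal_idempotent (e : S) : Prop :=
  e * e = e /\
  exists2 D : {set rees radical}, minimal_Dclass D & \pi_(rees radical) e \in D.

Definition minimal_idempotents : {set S} := [set e | `[< minimal_idempotent e >]].

End Radical.

(* Main.v *)
Require Import Defs.
From mathcomp Require Import all_boot boolp.

(* In a finite inverse semigroup the radical is zero, and the minimal
   idempotents are exactly the primitive ones, that is, the non-zero idempotents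
   minimal for the natural order.  If e is primitive and t = ex is non-zero, with
   inverse t', then tt' = e, g0 = t't is again primitive, and tg = t for every
   idempotent g with tg <> 0.  Thus exgyf is either 0 or exyf, and g0 realizes the
   value exyf; taking e primitive below xx' gives exg0 = ex <> 0. *)

Set Implicit Arguments.
Unset Strict Implicit.
Unset Printing Implicit Defensive.

Local Open Scope group_scope.

(** * Green's relations and principal ideals in a finite semigroup with zero *)

Section FiniteSemigroup.
Variable S : finSemigroup0Type.
Implicit Types (a b x : S) (u v : option S).

Lemma lmul1_left_ideal u a : u \in S1 S -> lmul1 u a \in left_ideal a.
Proof. by move=> hu; apply/imsetP; exists u. Qed.

Lemma rmul1_right_ideal u a : u \in S1 S -> rmul1 a u \in right_ideal a.
Proof. by move=> hu; apply/imsetP; exists u. Qed.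

Lemma mem_left_ideal a : a \in left_ideal a.
Proof.
by have [u hu hid] := S1_id S; apply/imsetP; exists u; rewrite ?(hid a).1.
Qed.

Lemma mem_right_ideal a : a \in right_ideal a.
Proof.
by have [u hu hid] := S1_id S; apply/imsetP; exists u; rewrite ?(hid a).2.
Qed.

Lemma left_ideal_sub_principal_ideal a : left_ideal a \subset principal_ideal a.
Proof.
have [w hw hid] := S1_id S; apply/subsetP=> _ /imsetP[u hu ->].
by apply/imset2P; exists u w; rewrite ?(hid _).2.
Qed.

Lemma right_ideal_sub_principal_ideal a :
  right_ideal a \subset principal_ideal a.
Proof.
have [w hw hid] := S1_id S; apply/subsetP=> _ /imsetP[u hu ->].
by apply/imset2P; exists w u; rewrite ?(hid _).1.
Qed.

Lemma mem_principal_ideal a : a \in principal_ideal a.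
Proof. exact: subsetP (left_ideal_sub_principal_ideal a) _ (mem_left_ideal a). Qed.

Lemma left_ideal_sub a x : x \in left_ideal a -> left_ideal x \subset left_ideal a.
Proof.
case/imsetP=> u hu ->; apply/subsetP=> _ /imsetP[v hv ->].
by have [w hw [wl _]] := S1_mul hv hu; apply/imsetP; exists w.
Qed.

Lemma right_ideal_sub a x :
  x \in right_ideal a -> right_ideal x \subset right_ideal a.
Proof.
case/imsetP=> u hu ->; apply/subsetP=> _ /imsetP[v hv ->].
by have [w hw [_ wr]] := S1_mul hu hv; apply/imsetP; exists w.
Qed.

(* Stability by counting: if a = u x a v, then S^1 a is contained in (S^1 x a) v,
   so it has at most as many elements as its subset S^1 x a. *)
Lemma left_ideal_stable a x :
  x \in left_ideal a -> a \in principal_ideal x -> left_ideal x = left_ideal a.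
Proof.
move=> hx /imset2P[u v hu hv e]; apply/eqP.
rewrite eqEcard left_ideal_sub //=.
apply: leq_trans (leq_imset_card (fun z => rmul1 z v) _).
apply/subset_leq_card/subsetP=> _ /imsetP[w hw ->]; rewrite e.
have [z hz [zl _]] := S1_mul hw hu.
by apply/imsetP; exists (lmul1 z x); rewrite ?lmul1_left_ideal // lrmul1C zl.
Qed.

Lemma right_ideal_stable a x :
  x \in right_ideal a -> a \in principal_ideal x ->
  right_ideal x = right_ideal a.
Proof.
move=> hx /imset2P[u v hu hv e]; apply/eqP.
rewrite eqEcard right_ideal_sub //=.
apply: leq_trans (leq_imset_card (lmul1 u) _).
apply/subset_leq_card/subsetP=> _ /imsetP[w hw ->]; rewrite e.
have [z hz [_ zr]] := S1_mul hv hw.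
by apply/imsetP; exists (rmul1 x z); rewrite ?rmul1_right_ideal // lrmul1C zr.
Qed.

Lemma eq_principal_ideal a b :
  a \in principal_ideal b -> b \in principal_ideal a ->
  principal_ideal a = principal_ideal b.
Proof. by move=> ab ba; apply/eqP; rewrite eqEsubset !principal_ideal_sub. Qed.

(** This is D = J for finite semigroups. If [b = uav] generates the same ideal as [a], then [c = ua]
    lies between them, and stability makes [c] L-related to [a] and R-related to [b]. *)
Lemma greenDE a b : greenD a b = (principal_ideal a == principal_ideal b).
Proof.
have subL x := subsetP (left_ideal_sub_principal_ideal x).
have subR x := subsetP (right_ideal_sub_principal_ideal x).
apply/existsP/eqP => [[c /andP[/eqP ac /eqP cb]]|eqab].
  apply: (@etrans _ _ (principal_ideal c)); apply: eq_principal_ideal.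
  - by apply: subL; rewrite -ac mem_left_ideal.
  - by apply: subL; rewrite ac mem_left_ideal.
  - by apply: subR; rewrite -cb mem_right_ideal.
  - by apply: subR; rewrite cb mem_right_ideal.
have : b \in principal_ideal a by rewrite eqab mem_principal_ideal.
case/imset2P=> u v hu hv eb.
have cL : lmul1 u a \in left_ideal a by apply: lmul1_left_ideal.
have bR : b \in right_ideal (lmul1 u a) by rewrite eb rmul1_right_ideal.
have ca := principal_ideal_sub (subL _ _ cL).
have bc := principal_ideal_sub (subR _ _ bR).
have ac : a \in principal_ideal (lmul1 u a).
  by apply: (subsetP bc); rewrite -eqab mem_principal_ideal.
have cb : lmul1 u a \in principal_ideal b.
  by rewrite -eqab (subsetP ca) ?mem_principal_ideal.
exists (lmul1 u a).
by rewrite /greenL /greenR (left_ideal_stable cL ac) (right_ideal_stable bR cb) !eqxx.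
Qed.

Lemma mem_Dclass a : a \in Dclass a.
Proof. by rewrite inE greenDE. Qed.

Lemma mem_Dclass_ideal a b :
  (b \in Dclass a) = (principal_ideal a == principal_ideal b).
Proof. by rewrite inE greenDE. Qed.

Lemma eq_Dclass a b :
  (Dclass a == Dclass b) = (principal_ideal a == principal_ideal b).
Proof.
apply/eqP/eqP => [eqD|eqI].
  by apply/eqP; rewrite -mem_Dclass_ideal eqD mem_Dclass.
by apply/setP=> c; rewrite !mem_Dclass_ideal eqI.
Qed.

Lemma Dclass0 : Dclass (0 : S) = [set 0].
Proof.
apply/setP=> c; rewrite mem_Dclass_ideal in_set1; apply/eqP/eqP => [e|-> //].
by apply/eqP; rewrite -in_set1 -principal_ideal0 e mem_principal_ideal.
Qed.

End FiniteSemigroup.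

(** Where idempotents commute, the one-sided equation [e * h = h] already says that [h] is below [e]
    in the natural order. *)
Definition primitive_idempotent (S : finSemigroup0Type) (e : S) : Prop :=
  [/\ e * e = e, e <> 0 & forall h, h * h = h -> e * h = h -> h <> 0 -> h = e].

(** * Inverses, commuting idempotents and the vanishing of the radical *)

Section InverseSemigroup.
Variable S : finSemigroup0Type.
Hypothesis hS : inverse_semigroup S.
Implicit Types (a b e f g h p t x y : S).

Lemma inverse_exists x : exists y, x * y * x = x /\ y * x * y = y.
Proof. by have [y [hy _]] := hS x; exists y. Qed.

Lemma inverse_unique x y z :
  x * y * x = x -> y * x * y = y -> x * z * x = x -> z * x * z = z -> y = z.
Proof.
by move=> h1 h2 h3 h4; have [w [_ hw]] := hS x; rewrite -(hw y) ?(hw z).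
Qed.

(* If z is the inverse of ef, then so is fze; hence z = fze is idempotent, so it
   is its own inverse and z = ef. *)
Lemma idempotent_mul e f :
  e * e = e -> f * f = f -> e * f * (e * f) = e * f.
Proof.
move=> ee ff; have [z [h1 h2]] := inverse_exists (e * f).
have ez : z = f * z * e.
  apply: (inverse_unique h1 h2).
    by rewrite !mulgA -(mulgA e f f) ff -(mulgA _ e e) ee -mulgA h1.
  by rewrite -[in RHS]h2 !mulgA -(mulgA _ e e) ee -(mulgA _ f f) ff.
have zz : z * z = z.
  have fzeE : f * z * e * (f * z * e) = f * (z * (e * f) * z) * e by rewrite !mulgA.
  by rewrite ez fzeE h2.
have -> : e * f = z by apply: (inverse_unique h2 h1); rewrite !zz.
exact: zz.
Qed.

(** Both [ef], being idempotent, and [fe] are inverses of [ef]. *)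
Lemma idempotent_comm e f : e * e = e -> f * f = f -> e * f = f * e.
Proof.
move=> ee ff; have ef := idempotent_mul ee ff.
have fe := idempotent_mul ff ee.
apply: (inverse_unique (x := e * f)); rewrite ?ef //.
  by rewrite !mulgA -(mulgA e f f) ff -(mulgA _ e e) ee -mulgA.
by rewrite !mulgA -(mulgA f e e) ee -(mulgA _ f f) ff -mulgA.
Qed.

(** If [y] is the inverse of [x], the idempotent [xy] lies in every power of [(x)]. Nilpotency
    forces [xy = 0], hence [x = xyx = 0]. *)
Lemma radical_eq0 x : x \in radical_set S -> x = 0.
Proof.
rewrite inE => /asboolP[m hm]; have [y [h1 _]] := inverse_exists x.
have xyI : x * y * (x * y) = x * y by rewrite mulgA h1.
suff: x * y \in iter m (setmul (principal_ideal x)) (principal_ideal x).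
  by rewrite hm inE => /eqP xy0; rewrite -h1 xy0 mul0s.
elim: m {hm} => [|m IH] /=; first exact: mulr_principal_ideal.
by rewrite -xyI imset2_f // mulr_principal_ideal.
Qed.

(** * Passage between [S] and its quotient by the radical *)

Local Notation pr := (\pi_(rees (radical S)))%qT.

Lemma pi_radical_inj : injective pr.
Proof.
move=> x y /eqP; rewrite rees_piE => /orP[/eqP //|/andP[/= hx hy]].
by rewrite (radical_eq0 hx) (radical_eq0 hy).
Qed.

Lemma pi_radicalM x y : pr (x * y) = pr x * pr y.
Proof. by rewrite -[RHS]/(rees_mul _ _) rees_mul_pi. Qed.

Lemma pi_radical_neq0 x : x <> 0 -> pr x <> 0.
Proof. by move=> x0 /pi_radical_inj. Qed.

(** A non-zero idempotent [h] below [e] has its class below that of [e], so minimality makes the two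
    classes equal. Stability then makes the right ideals of [h] and [e] equal, which gives [he = e]
    and [h = e]. *)
Lemma minimal_idempotent_primitive e :
  minimal_idempotent e -> primitive_idempotent e.
Proof.
case=> ee [D [/imsetP[a _ ->] D0 minD]] eD.
have eqD : Dclass a = Dclass (pr e).
  by apply/eqP; rewrite eq_Dclass -mem_Dclass_ideal.
rewrite {a}eqD in D0 minD {eD}.
split=> // [e0|h hh eh h0]; first by apply: D0; rewrite e0 -[pr 0]/0 Dclass0.
have hR : pr h \in right_ideal (pr e).
  by apply/imsetP; exists (Some (pr h)); rewrite ?S1_some //= -pi_radicalM eh.
have hI := subsetP (right_ideal_sub_principal_ideal (pr e)) _ hR.
have /minD[] : Dclass (pr h) \in Dclasses (rees (radical S)) by apply: imset_f.
- apply/existsP; exists (pr h); apply/existsP; exists (pr e).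
  by rewrite !eqxx principal_ideal_sub.
- move/eqP; rewrite eq_Dclass => /eqP eqI.
  have eI : pr e \in principal_ideal (pr h) by rewrite eqI mem_principal_ideal.
  have : pr e \in right_ideal (pr h).
    by rewrite (right_ideal_stable hR eI) mem_right_ideal.
  case/imsetP=> u _ eu.
  (* The idempotent [h] fixes on the left every element of its right ideal, in particular [e]. *)
  have /pi_radical_inj he : pr (h * e) = pr e.
    by rewrite pi_radicalM eu; case: u {eu} => [s|] /=;
      rewrite ?mulgA -pi_radicalM hh.
  by rewrite -eh (idempotent_comm ee hh).
- move=> D0h; have := mem_Dclass (pr h); rewrite D0h inE => /eqP.
  by move/(pi_radical_neq0 h0).
Qed.

(** * Products with a primitive idempotent *)

Lemma inverse_neq0 t t' : t * t' * t = t -> t <> 0 -> t * t' <> 0.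
Proof. by move=> h1 t0 tt0; apply: t0; rewrite -h1 tt0 mul0s. Qed.

Lemma primitive_mul_inverse e t t' :
  primitive_idempotent e -> e * t = t -> t <> 0 -> t * t' * t = t -> t * t' = e.
Proof.
case=> ee e0 minE et t0 h1; apply: minE; first by rewrite mulgA h1.
  by rewrite mulgA et.
exact: inverse_neq0 h1 t0.
Qed.

Lemma idempotent_conj t t' k :
  t * t' * t = t -> t' * t * t' = t' -> k * k = k ->
  t * k * t' * (t * k * t') = t * k * t'.
Proof.
move=> h1 h2 kk; have hI : t' * t * (t' * t) = t' * t by rewrite mulgA h2.
have kc := idempotent_comm kk hI.
rewrite -!mulgA (mulgA t' t) (mulgA k (t' * t)) kc -!mulgA (mulgA k k) kk.
by rewrite !mulgA h1.
Qed.

(** The element [tgt'] is a non-zero idempotent below [e], so it equals [e]. As [g] commutes with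
    [t't], this yields [tg = tgt't = et = t]. *)
Lemma primitive_mulr_idempotent e t g :
  primitive_idempotent e -> e * t = t -> g * g = g -> t * g <> 0 -> t * g = t.
Proof.
move=> pe et gg tg0; have [t' [h1 h2]] := inverse_exists t.
have t0 : t <> 0 by move=> t0; apply: tg0; rewrite t0 mul0s.
have hI : t' * t * (t' * t) = t' * t by rewrite mulgA h2.
have gc := idempotent_comm gg hI.
have tgt : t * g * t' * t = t * g.
  by rewrite -!mulgA gc !mulgA h1.
have cE : t * g * t' = e.
  have [_ _ minE] := pe; apply: minE; first exact: idempotent_conj.
    by rewrite !mulgA et.
  by move=> c0; apply: tg0; rewrite -tgt c0 mul0s.
by rewrite -tgt cE.
Qed.

(** If [k] is a non-zero idempotent below [t't], then [k = t'tk] shows [tk] to be non-zero. Hence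
    [tk = t], and [k = t'tk = t't]. *)
Lemma primitive_source e t t' :
  primitive_idempotent e -> e * t = t -> t <> 0 ->
  t * t' * t = t -> t' * t * t' = t' -> primitive_idempotent (t' * t).
Proof.
move=> pe et t0 h1 h2; split=> [||k kk tk k0].
- by rewrite mulgA h2.
- by move=> z; apply: t0; rewrite -h1 -mulgA z muls0.
have tkt : t * k = t.
  apply: (primitive_mulr_idempotent pe et kk) => z.
  by apply: k0; rewrite -tk -mulgA z muls0.
by rewrite -tk -mulgA tkt.
Qed.

(** By finiteness, [e] can be taken among the non-zero idempotents below [p] with the fewest
    idempotents under it. A non-zero [h] below [e] then has the same down-set, which contains [e],
    so [h = e]. *)
Lemma exists_primitive p :
  p * p = p -> p <> 0 -> exists2 e, primitive_idempotent e & p * e = e.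
Proof.
move=> pp p0.
pose P e := [&& e * e == e, p * e == e & e != 0].
pose down e := [set h : S | (h * h == h) && (e * h == h)].
have Pp : P p by rewrite /P pp eqxx; apply/eqP.
case: (arg_minnP (fun e => #|down e|) Pp) => e /and3P[/eqP ee /eqP pe /eqP e0] minE.
exists e => //; split=> // h hh eh h0.
have Ph : P h by rewrite /P hh -eh mulgA pe eh !eqxx; apply/eqP.
have sub : down h \subset down e.
  apply/subsetP=> k; rewrite !inE => /andP[-> /eqP hk].
  by rewrite -hk mulgA eh eqxx.
have /eqP eqd : down h == down e by rewrite eqEcard sub minE.
have : e \in down h by rewrite eqd inE ee eqxx.
by rewrite inE => /andP[_ /eqP he]; rewrite -eh (idempotent_comm ee hh).
Qed.

(** Every non-zero element of [SeS] generates [e]: the inverse [t'] of [ae] satisfies [t'ae = e],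
    and the inverse [s'] of [eb] satisfies [ebs' = e]. *)
Lemma primitive_ideal_minimal e a b :
  primitive_idempotent e -> a * e * b <> 0 ->
  exists c d, e = c * (a * e * b) * d.
Proof.
move=> pe y0; have [ee e0 minE] := pe.
have ae0 : a * e <> 0 by move=> z; apply: y0; rewrite z mul0s.
have eb0 : e * b <> 0 by move=> z; apply: y0; rewrite -mulgA z muls0.
have [t' [h1 _]] := inverse_exists (a * e).
have [s' [k1 _]] := inverse_exists (e * b).
exists t', s'.
have teE : t' * (a * e) = e.
  have tI : t' * (a * e) * (t' * (a * e)) = t' * (a * e).
    by rewrite -mulgA (mulgA (a * e)) h1.
  have te : t' * (a * e) * e = t' * (a * e) by rewrite -!mulgA ee.
  apply: minE => //; first by rewrite (idempotent_comm ee tI).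
  by move=> z; apply: ae0; rewrite -h1 -mulgA z muls0.
have ebe : e * (e * b) = e * b by rewrite mulgA ee.
have ebs := primitive_mul_inverse pe ebe eb0 k1.
by rewrite -!mulgA (mulgA e b) ebs teE.
Qed.

Lemma primitive_minimal_idempotent e :
  primitive_idempotent e -> minimal_idempotent e.
Proof.
move=> pe; have [ee e0 minE] := pe; split=> //.
exists (Dclass (pr e)); last exact: mem_Dclass.
split; first exact: imset_f.
  move=> D0; have := mem_Dclass (pr e); rewrite D0 inE => /eqP.
  exact: pi_radical_neq0.
move=> D' _ /existsP[a /existsP[b /and3P[/eqP-> /eqP eD sab]]].
have eqI : principal_ideal (pr e) = principal_ideal b.
  by apply/eqP; rewrite -eq_Dclass eD.
case: (eqVneq a 0) => [->|/eqP a0]; first by right; rewrite Dclass0.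
left; apply/eqP; rewrite eq_Dclass; apply/eqP.
have aI : a \in principal_ideal (pr e).
  by rewrite eqI (subsetP sab) ?mem_principal_ideal.
apply: eq_principal_ideal => //.
have [c [d ea]] : exists c d, a = pr (c * e * d).
  case/imset2P: aI => u v _ _ ->.
  (* Where a factor is the adjoined identity, [e] replaces it, which is harmless next to the
     idempotent [e]. *)
  exists (if u is Some s then repr s else e), (if v is Some s then repr s else e).
  have pee : pr e * pr e = pr e by rewrite -pi_radicalM ee.
  by case: u => [s|]; case: v => [t|] /=;
    rewrite !pi_radicalM ?reprK ?pee -?mulgA ?pee.
have y0 : c * e * d <> 0 by move=> z; apply: a0; rewrite ea z.
have [c' [d' eE]] := primitive_ideal_minimal pe y0.
rewrite ea; apply/imset2P.
exists (Some (pr c')) (Some (pr d')); rewrite ?S1_some //=.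
by rewrite -(pi_radicalM c') -pi_radicalM -eE.
Qed.

Lemma mem_minimal_idempotents e :
  e \in minimal_idempotents S <-> primitive_idempotent e.
Proof.
rewrite inE; split=> [/asboolP|pe]; first exact: minimal_idempotent_primitive.
by apply/asboolP; apply: primitive_minimal_idempotent.
Qed.

(** With [t = ex] and inverse [t'], the right unit is [t't]. *)
Lemma primitive_right_unit e x :
  primitive_idempotent e -> e * x <> 0 ->
  exists2 g, primitive_idempotent g & e * x * g = e * x.
Proof.
move=> pe ex0; have [ee _ _] := pe.
have [t' [h1 h2]] := inverse_exists (e * x).
exists (t' * (e * x)); last by rewrite !mulgA in h1 *.
by apply: (primitive_source pe _ ex0 h1 h2); rewrite mulgA ee.
Qed.

End InverseSemigroup.

Theorem theorem5p4 (S : finSemigroup0Type) (hS : inverse_semigroup S) :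
  let M := minimal_idempotents S in
  [/\ forall e f : S, e \in M -> f \in M -> e * f = f * e,
      forall x : S, x <> 0 -> exists e f : S,
        [/\ e \in M, f \in M & e * x * f <> 0]
    & forall x y e f : S, e \in M -> f \in M ->
        [set e * x * g * y * f | g in M] \subset [set 0; e * x * y * f] /\
        (e * x * y * f <> 0 -> [set e * x * g * y * f | g in M] <> [set 0])].
Proof.
move=> M; have ME e : e \in M <-> primitive_idempotent e.
  exact: mem_minimal_idempotents.
split.
- by move=> e f /ME[ee _ _] /ME[ff _ _]; apply: idempotent_comm.
- move=> x x0; have [x' [h1 h2]] := inverse_exists hS x.
  have xI : x * x' * (x * x') = x * x' by rewrite mulgA h1.
  have [e pe xe] := exists_primitive hS xI (inverse_neq0 h1 x0).
  have [ee e0 _] := pe.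
  (* Since [e] is below [xx'], one has [e = exx'], which would vanish with [ex]. *)
  have ex0 : e * x <> 0.
    move=> z; apply: e0.
    by rewrite -xe -(idempotent_comm hS ee xI) mulgA z mul0s.
  have [f pf exf] := primitive_right_unit hS pe ex0.
  by exists e, f; split; rewrite ?exf //; apply/ME.
- move=> x y e f /ME pe _; have [ee _ _] := pe; split.
    apply/subsetP=> _ /imsetP[g /ME[gg _ _] ->]; rewrite !inE.
    case: (eqVneq (e * x * g) 0) => [->|/eqP exg0]; first by rewrite !mul0s eqxx.
    have eex : e * (e * x) = e * x by rewrite mulgA ee.
    by rewrite (primitive_mulr_idempotent hS pe eex gg exg0) eqxx orbT.
  move=> z0 M0.
  have ex0 : e * x <> 0 by move=> z; apply: z0; rewrite z !mul0s.
  (* For this [g] the product [exgyf] is [exyf], so the set has a non-zero member. *)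
  have [g /ME gM exg] := primitive_right_unit hS pe ex0.
  have : e * x * g * y * f \in [set e * x * g * y * f | g in M].
    exact: (imset_f (fun g => e * x * g * y * f)).
  by rewrite M0 inE exg => /eqP.
Qed.
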